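(* Let $X$ and $Y$ be metrizable spaces. If $h:\varrho(X)\to\varrho(Y)$ is a homeomorphism, then $h[\varrho(\mathrm{cl}_X(LX))]=\varrho(\mathrm{cl}_Y(LY))$ and $h[\varrho(NX)]=\varrho(NY)$.
   Context: For a Tychonoff space $X$, $\beta X$ is its Čech–Stone compactification and $X^\ast=\beta X\setminus X$. A point $p\in X^\ast$ is a remote point of $X$ if $p\notin \mathrm{cl}_{\beta X}(A)$ for every nowhere dense subset $A$ of $X$. $\varrho(X)$ denotes the set of remote points of $X$, with the subspace topology from $\beta X$. For any space $X$, $LX$ is the set of points of $X$ at which $X$ is locally compact (those having a compact neighborhood in $X$), and $NX=X\setminus \mathrm{cl}_X(LX)$. For a regular closed subset $A$ of a normal space $X$, $\mathrm{cl}_{\beta X}(A)$ is identified with $\beta A$, and under this identification $\varrho(A)=\varrho(X)\cap\mathrm{cl}_{\beta X}(A)$; in this way $\varrho(\mathrm{cl}_X(LX))$ and $\varrho(\mathrm{cl}_X(NX))$ are regarded as subsets of $\varrho(X)$. The source further uses the identification $\varrho(U)=\varrho(Z)$ for $U$ an open dense subset of a normal space $Z$; it is through this identification, with $U=NX$ and $Z=\mathrm{cl}_X(NX)$, that $\varrho(NX)$ is treated as a subset of $\varrho(X)$. The same conventions apply to $Y$. *)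

(* Defs.v *)
From HB Require Import structures.
From mathcomp Require Import all_boot all_order all_algebra.
From mathcomp Require Import all_classical all_reals all_analysis.

Set Implicit Arguments.
Unset Strict Implicit.
Unset Printing Implicit Defensive.

Local Open Scope classical_set_scope.

Definition homeomorphism (S T : topologicalType) (f : S -> T) : Prop :=
  exists g : T -> S,
    [/\ cancel f g, cancel g f, continuous f & continuous g].

Definition metrizable (R : realType) (X : topologicalType) : Prop :=
  exists (M : metricType R) (f : X -> M), homeomorphism f.

Definition embedding (S T : topologicalType) (f : S -> T) : Prop :=
  injective f /\
  forall U : set S, open U <-> exists2 V : set T, open V & U = f @^-1` V.

(* [stone_cech e]: the space [bX], with [e] as the inclusion of [X] in it, is
   the Cech-Stone compactification of [X]; this determines ([bX], [e]) up to a
   unique homeomorphism under [X]. *)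
Record stone_cech (X bX : topologicalType) (e : X -> bX) : Prop := StoneCech {
  stone_cech_compact : compact [set: bX];
  stone_cech_hausdorff : hausdorff_space bX;
  stone_cech_embedding : embedding e;
  stone_cech_dense : dense (range e);
  stone_cech_extension : forall (K : topologicalType) (f : X -> K),
    compact [set: K] -> hausdorff_space K -> continuous f ->
    exists2 F : bX -> K, continuous F & forall x, F (e x) = f x }.

Definition nowhere_dense (X : topologicalType) (D : set X) : Prop :=
  interior (closure D) = set0.

(* The remote points of [X], where the closure of [range e] in [B] plays the
   role of the Cech-Stone compactification of [X]. If [stone_cech e] holds then
   [closure (range e)] is the whole space; the general form also covers the
   closure in the compactification of [X] of a subspace, see [remote_in]. *)
Definition remote (X B : topologicalType) (e : X -> B) : set B :=
  [set p | [/\ closure (range e) p, ~ range e p &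
    forall D : set X, nowhere_dense D -> ~ closure (e @` D) p]].

(* For [A] regular closed in [X]: the remote points of the subspace [A] (the
   type [set_type A] with its subspace topology), as a set of remote points of
   [X]. The Cech-Stone compactification of [A] is identified with the closure
   of [A] in that of [X], so the inclusion of [A] in it is [e \o set_val]. *)
Definition remote_in (X bX : topologicalType) (e : X -> bX) (A : set X) :
    set (remote e) :=
  set_val @^-1` remote (e \o (set_val : A -> X)).
Arguments remote_in {X bX} e A.

(* For [U] open in [X]: the remote points of [U], as a set of remote points of
   [X], by way of the identification of the remote points of [U] with those of
   its closure, in which [U] is open and dense. Pitfall: the compactification
   of [U] itself can have remote points lying over points of [X], as for
   [U = (0, 1)] in [X = [0, 1]]; these are not remote points of [X]. *)
Definition remote_in_open (X bX : topologicalType) (e : X -> bX) (U : set X) :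
    set (remote e) :=
  remote_in e (closure U).
Arguments remote_in_open {X bX} e U.

Definition lc_points (X : topologicalType) : set X :=
  [set x | exists2 K : set X, nbhs x K & compact K].
Arguments lc_points : clear implicits.

Definition nlc_points (X : topologicalType) : set X :=
  ~` closure (lc_points X).
Arguments nlc_points : clear implicits.

(* Main.v *)
Require Import Defs.
From HB Require Import structures.
From mathcomp Require Import all_boot all_order all_algebra.
From mathcomp Require Import all_classical all_reals all_analysis.
From mathcomp Require Import lra.

(* For U open in X let rho U be the set of remote points of X lying in the
   closure of U in the Cech-Stone compactification. As boundaries of open sets
   are nowhere dense, the sets rho U form a base of clopen sets of the space of
   remote points, and rho U, rho (~` closure U) partition it.
   Remote points exist along every locally finite sequence of nonempty open
   sets V_n: for each n there is a family, indexed by the nowhere dense sets D,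
   of sets inside V_n with closure missing D such that any n members meet; a
   point of the compactification in the closure of the tails of all the unions
   over n of these sets is remote.
   A clopen piece of the remote points of the locally compact part contains a
   rho V, with V the union of a locally finite sequence of relatively compact
   open sets, in which every nonempty G_delta has nonempty interior: a diagonal
   choice works, because relatively compact sets do not see remote points. In
   the nowhere locally compact part every nonempty open set rho U contains a
   point of a G_delta with empty interior, namely the intersection of the
   rho (V_k u V_k+1 u ...) for a locally finite sequence V_n in U: locally only
   finitely many V_n are met, and every nonempty open subset of U has remote
   points. So no homeomorphism can mix the two parts. *)

Set Implicit Arguments.
Unset Strict Implicit.
Unset Printing Implicit Defensive.

Import Order.TTheory GRing.Theory Num.Theory.
Import numFieldNormedType.Exports.

Local Open Scope classical_set_scope.

(** * Metrizable spaces *)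

Lemma compact_set_type (T : topologicalType) (A : set T) :
  compact A -> compact [set: A].
Proof.
move=> cA F FF _; pose G : set_system T := (set_val : A -> T) @ F.
have GF : ProperFilter G by exact: fmap_proper_filter.
have GA : G A by apply: (@filterE _ F) => x; exact: set_valP.
have [p [Ap Gp]] := cA G GF GA.
exists (exist _ p (mem_set Ap)); split=> // B C FB [_ [[U oU <-] Up UC]].
have GB : G (set_val @` B).
  by rewrite /G /fmap /=; apply: filterS FB => x Bx; exists x.
have [_ [[x Bx <-] Ux]] := Gp _ _ GB (open_nbhs_nbhs (conj oU Up)).
by exists x; split=> //; exact: UC.
Qed.

Lemma hausdorff_set_type (T : topologicalType) (A : set T) :
  hausdorff_space T -> hausdorff_space A.
Proof.
move=> hT p q pq; apply: eq_sig_hprop => [x|]; first exact: bool_irrelevance.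
apply: hT => B C pB qC.
have [r [Br Cr]] := pq _ _ (@initial_continuous A T set_val p B pB)
  (@initial_continuous A T set_val q C qC).
by exists (set_val r).
Qed.

Section metrizable_spaces.
Local Open Scope ring_scope.
Context {R : realType} {X : topologicalType}.
Hypothesis mX : metrizable R X.

(** Urysohn's lemma for the normal space [M], carried back to [X] along the homeomorphism. *)
Lemma metrizable_separation (A B : set X) :
  closed A -> closed B -> A `&` B = set0 ->
  exists f : X -> R, [/\ continuous f, range f `<=` `[0, 1],
    forall x, A x -> f x = 0 & forall x, B x -> f x = 1].
Proof.
have [M [f [g [fK gK cf cg]]]] := mX.
move=> cA cB AB0.
have nM : normal_space M by exact: (@pseudometric_normal R).
have := @normal_separatorP R M; move=> -[/(_ nM) sepM _].
have /(@uniform_separatorP _ R)[u [cu u01 uA uB]] :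
    uniform_separator (g @^-1` A) (g @^-1` B).
  apply: sepM.
  - by apply: preimage_closed => // x _; exact: cg.
  - by apply: preimage_closed => // x _; exact: cg.
  - by rewrite -preimage_setI AB0 preimage_set0.
exists (u \o f); split.
- by move=> x; apply: continuous_comp; [exact: cf|exact: cu].
- by move=> _ [x _ <-]; apply: u01; exists (f x).
- by move=> x Ax; apply: uA; exists (f x) => //=; rewrite fK.
- by move=> x Bx; apply: uB; exists (f x) => //=; rewrite fK.
Qed.

(** The metric is a plain function tied to the given neighbourhoods, so that [X] keeps its own
    topology. *)
Definition metrizes (d : X -> X -> R) := [/\ forall x, d x x = 0,
  forall x y, d x y = d y x, forall x y z, d x z <= d x y + d y z &
  forall x (U : set X), nbhs x U <->
    exists2 e, 0 < e & forall y, d x y < e -> U y].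

Lemma metrizableE : exists d, metrizes d.
Proof.
have [M [f [g [fK gK cf cg]]]] := mX.
exists (fun x y => mdist (f x) (f y)); split.
- by move=> x; exact: mdistxx.
- by move=> x y; exact: metric_sym.
- by move=> x y z; exact: metric_triangle.
- move=> x U; split.
  + move=> xU; have : nbhs (f x) (g @^-1` U) by apply: cg; rewrite fK.
    move=> /nbhs_ballP[e /= e0 eU]; exists e => // y xy.
    by have := eU (f y); rewrite ballEmdist /= fK; exact.
  + move=> [e e0 eU].
    have xe : nbhs x (f @^-1` ball (f x) e) by exact/cf/nbhsx_ballx.
    by apply: filterS xe => y; rewrite /= ballEmdist; exact: eU.
Qed.

End metrizable_spaces.

Lemma metrizable_regular (R : realType) (X : topologicalType) (x : X)
    (U : set X) : metrizable R X -> nbhs x U ->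
  exists2 W, open_nbhs x W & closure W `<=` U.
Proof.
move=> [M [f [g [fK gK cf cg]]]] xU.
have [W xW WU] : filter_from (nbhs (f x)) closure (g @^-1` U).
  by apply: (@uniform_regular M); apply: cg; rewrite fK.
exists (f @^-1` W°).
  by split; [apply: open_comp (open_interior W) => y _; exact: cf|exact: xW].
apply: (@subset_trans _ (f @^-1` closure W)); last first.
  by move=> y /WU; rewrite /= fK.
have cW : closed (f @^-1` closure W).
  by apply: preimage_closed; [move=> y _; exact: cf|exact: closed_closure].
rewrite [X in _ `<=` X](closure_id _).1//; apply: closureS => y yW.
by apply: subset_closure; exact: interior_subset yW.
Qed.

(** * Locally finite families *)

Lemma filter_bigcap_finite (T : Type) (I : choiceType) (F : set_system T)
    (D : set I) (f : I -> set T) : Filter F -> finite_set D ->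
  (forall i, D i -> F (f i)) -> F (\bigcap_(i in D) f i).
Proof. by move=> FF /finite_fsetP[E ->] Ff; exact: filter_bigI. Qed.

Definition locally_finite (X : topologicalType) (I : Type) (D : set I)
    (F : I -> set X) :=
  forall x : X, exists2 W, nbhs x W &
    finite_set [set i | D i /\ W `&` F i !=set0].

(** A point outside every [closure (F i)] has a neighbourhood meeting only finitely many [F i];
    removing their closures leaves a neighbourhood that misses the union. *)
Lemma closure_locally_finite (X : topologicalType) (I : choiceType) (D : set I)
    (F : I -> set X) : locally_finite D F ->
  closure (\bigcup_(i in D) F i) `<=` \bigcup_(i in D) closure (F i).
Proof.
move=> lfF x xF; have [W xW finW] := lfF x.
apply: contrapT => xNF.
pose N := \bigcap_(i in [set i | D i /\ W `&` F i !=set0]) ~` closure (F i).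
have xN : nbhs x N.
  apply: filter_bigcap_finite => // i [Di _].
  apply: open_nbhs_nbhs; split; first exact/closed_openC/closed_closure.
  by move=> xFi; apply: xNF; exists i.
have [y [[i Di Fiy] [Wy Ny]]] := xF _ (filterI xW xN).
apply: (Ny i); first by split=> //; exists y.
exact: subset_closure.
Qed.

Lemma locally_finite_sub (X : topologicalType) (I : Type) (D E : set I)
    (F G : I -> set X) : E `<=` D -> (forall i, E i -> G i `<=` F i) ->
  locally_finite D F -> locally_finite E G.
Proof.
move=> ED GF lfF x; have [W xW finW] := lfF x; exists W => //.
apply: sub_finite_set finW => i [Ei [y [Wy Gy]]]; split; first exact: ED.
by exists y; split=> //; exact: GF.
Qed.

Lemma locally_finite_setU (X : topologicalType) (I : Type) (D E : set I)
    (F : I -> set X) : locally_finite D F -> locally_finite E F ->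
  locally_finite (D `|` E) F.
Proof.
move=> lfD lfE x; have [V xV finV] := lfD x; have [W xW finW] := lfE x.
exists (V `&` W); first exact: filterI.
apply: (@sub_finite_set _ _ ([set i | D i /\ V `&` F i !=set0] `|`
    [set i | E i /\ W `&` F i !=set0])); last by rewrite finite_setU.
by move=> i [[Di|Ei] [y [[Vy Wy] Fy]]]; [left|right]; split=> //; exists y.
Qed.

(** * Pi-bases and noncompactness in metric spaces *)

Section metrized_spaces.
Local Open Scope ring_scope.
Context {R : realType} {X : topologicalType} (d : X -> X -> R).
Hypothesis metrizes_d : metrizes d.

Let dxx x : d x x = 0. Proof. by case: metrizes_d. Qed.
Let dC x y : d x y = d y x. Proof. by case: metrizes_d. Qed.
Let dT x y z : d x z <= d x y + d y z. Proof. by case: metrizes_d. Qed.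
Let nbhsd x (U : set X) :
  nbhs x U <-> exists2 e, 0 < e & forall y, d x y < e -> U y.
Proof. by case: metrizes_d. Qed.

Let dball x (e : R) : set X := [set y | d x y < e].

Let dball_open x e : open (dball x e).
Proof.
rewrite openE => y xy; apply/nbhsd; exists (e - d x y).
  by rewrite subr_gt0.
by move=> z yz; rewrite /dball /=; have := dT x y z; move: yz; lra.
Qed.

Let nbhs_dball x e : 0 < e -> nbhs x (dball x e).
Proof. by move=> e0; apply/nbhsd; exists e. Qed.

Let ex_natSinv (e : R) : 0 < e -> exists n : nat, forall m, (n <= m)%N ->
  m.+1%:R^-1 < e.
Proof.
move=> e0; have [n _ nP] := near_infty_natSinv_lt (PosNum e0).
by exists n => m nm; exact: nP.
Qed.

(** Zorn's lemma among the [e]-separated subsets of [K]: a point at distance at least [e] from all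
    of a maximal one could be added to it. *)
Lemma maximal_separated (K : set X) (e : R) : 0 < e -> exists A : set X,
  [/\ A `<=` K, forall x y, A x -> A y -> d x y < e -> x = y &
      forall x, K x -> exists2 a, A a & d a x < e].
Proof.
move=> e0; pose P (A : set X) := A `<=` K /\
  forall x y, A x -> A y -> d x y < e -> x = y.
have [F FP Ftot|A [[AK Asep] Amax]] := @Zorn_bigcup X P.
  split=> [x [A FA Ax]|x y [A FA Ax] [B FB By]]; first exact: (FP _ FA).1.
  by have [AB|BA] := Ftot _ _ FA FB;
    [apply: (FP _ FB).2 => //; exact: AB|apply: (FP _ FA).2 => //; exact: BA].
exists A; split=> // x Kx; apply: contrapT => xA.
have xNA a : A a -> e <= d a x.
  by move=> Aa; rewrite leNgt; apply/negP => ax; apply: xA; exists a.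
apply: (Amax (x |` A)).
  split; first by move=> a Aa; right.
  move=> /(_ x (or_introl erefl)) /xNA; rewrite dxx; move: e0; lra.
split; first by move=> t [->|/AK].
move=> a b [->|Aa] [->|Ab]//; last exact: Asep.
  by rewrite dC => ltb; exfalso; have := xNA _ Ab; move: ltb; lra.
by move=> lta; exfalso; have := xNA _ Aa; move: lta; lra.
Qed.

(** Take balls of radius [r / 3] about a maximal [r]-separated set, for [r = 1 / (n + 1)]. If two of
    them meet the same ball of radius [r / 6], their centres are closer than [r], hence equal. *)
Lemma metrized_pi_base : exists P : nat -> set (set X),
  [/\ forall n, locally_finite (P n) id,
      forall n U, P n U -> open U /\ U !=set0,
      forall m n, (m <= n)%N -> P m `<=` P n &
      forall U, open U -> U !=set0 -> exists n V, P n V /\ V `<=` U].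
Proof.
have r0 n : 0 < n.+1%:R^-1 :> R by rewrite invr_gt0.
have [A Amax] := choice (fun n => maximal_separated [set: X] (r0 n)).
pose P n := [set dball a (n.+1%:R^-1 / 3) | a in A n].
have lfP n : locally_finite (P n) id.
  move=> x; set r : R := n.+1%:R^-1.
  exists (dball x (r / 6)).
    by apply: nbhs_dball; rewrite divr_gt0// r0.
  have [[V PV]|noV] :=
    pselect (exists V, P n V /\ dball x (r / 6) `&` V !=set0).
    apply: (@sub_finite_set _ _ [set V]) => //= U.
    move: PV => [[a Aa <-] [y [xy ay]]] [[b Ab <-] [z [xz bz]]].
    suff -> : b = a by [].
    have [_ sepA _] := Amax n; apply: sepA => //.
    have := dT b z a; have := dT z x a; have := dT x y a.
    move: xy ay xz bz; rewrite /dball /= -/r (dC y a) (dC z x); lra.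
  suff -> : [set V | P n V /\ dball x (r / 6) `&` V !=set0] = set0 by [].
  by apply/seteqP; split=> // V PV; apply: noV; exists V.
(* Levels accumulate to make the family increasing in [n]; finite unions preserve local
   finiteness. *)
exists (fun n => \bigcup_(m in [set m | (m <= n)%N]) P m); split.
- elim=> [|n IHn].
    apply: locally_finite_sub (lfP 0%N) => [V [m /=]|V _ //].
    by rewrite leqn0 => /eqP->.
  apply: (@locally_finite_sub _ _
    (\bigcup_(m in [set m | (m <= n)%N]) P m `|` P n.+1) _ id) => [|V _ //|].
    2: exact: locally_finite_setU.
  move=> V [m /= ]; rewrite leq_eqVlt => /orP[/eqP-> ?|mn PV]; first by right.
  by left; exists m.
- move=> n U [m _ [a _ <-]]; split; first exact: dball_open.
  by exists a; rewrite /dball /= dxx divr_gt0// r0.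
- by move=> m n mn V [k /= km PV]; exists k => //=; exact: leq_trans mn.
- move=> U oU [x Ux]; have /nbhsd[e e0 eU] : nbhs x U by exact: open_nbhs_nbhs.
  (* If [r < e / 2] and [a] is within [r] of [x], the ball about [a] stays within [4 r / 3 < e] of
     [x]. *)
  have e20 : 0 < e / 2 by rewrite divr_gt0.
  have [n /(_ n (leqnn n)) nP] := ex_natSinv e20.
  have [_ _ /(_ x Logic.I)[a Aa ax]] := Amax n.
  exists n, (dball a (n.+1%:R^-1 / 3)); split.
    by exists n; [exact: leqnn|exists a].
  move=> y ay; apply: eU.
  have := dT x a y; move: ay ax nP (r0 n); rewrite /dball/= (dC x a).
  set r : R := n.+1%:R^-1; lra.
Qed.

(** If every sequence in [K] clusters, then [K] is totally bounded, so an ultrafilter on [K]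
    contains a ball of each radius [1 / (n + 1)]; a cluster point of the centres is its limit. *)
Lemma noncompact_sequence (K : set X) : closed K -> ~ compact K ->
  exists x : nat -> X, (forall n, K (x n)) /\
    forall z : X, exists2 W, nbhs z W & finite_set [set n | W (x n)].
Proof.
move=> cK ncK; apply: contrapT => noseq; apply: ncK.
have clus (x : nat -> X) : (forall n, K (x n)) ->
    exists z : X, forall W, nbhs z W -> infinite_set [set n | W (x n)].
  move=> Kx; apply: contrapT => noz; apply: noseq; exists x; split=> // z.
  apply: contrapT => noW; apply: noz; exists z => W zW finW; apply: noW.
  by exists W.
(* An infinite separated set would give an injective sequence with at most one term in any ball of
   radius [e / 2]. *)
have finsep (A : set X) (e : R) : 0 < e -> A `<=` K ->
    (forall x y, A x -> A y -> d x y < e -> x = y) -> finite_set A.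
  move=> e0 AK Asep; apply: contrapT => /infiniteP/card_leP[f].
  pose x n : X := \val (f (exist _ n (mem_set Logic.I))).
  have Ax n : A (x n) by exact: set_valP.
  have xinj m n : x m = x n -> m = n.
    move=> /val_inj/(@inj _ _ _ f); rewrite !in_setT => /(_ isT isT).
    by move=> /(congr1 \val).
  have [z zP] := clus x (fun n => AK _ (Ax n)).
  have /(zP _) : nbhs z (dball z (e / 2)).
    by apply: nbhs_dball; rewrite divr_gt0.
  have [[n zn]|none] := pselect (exists n, dball z (e / 2) (x n)).
    apply; apply: (@sub_finite_set _ _ [set n]) => //= m zm.
    apply/xinj/Asep => //; have := dT (x m) z (x n); move: zm zn.
    by rewrite /dball/= (dC (x m) z); lra.
  apply; suff -> : [set n | dball z (e / 2) (x n)] = set0 by [].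
  by apply/seteqP; split=> // n zn; apply: none; exists n.
rewrite compact_ultra => F FU FK.
have small n : exists2 c, K c & F (dball c n.+1%:R^-1).
  have r0 : 0 < n.+1%:R^-1 :> R by rewrite invr_gt0.
  have [A [AK Asep Amax]] := maximal_separated K r0.
  have finA : finite_set A by exact: (finsep _ _ r0).
  apply: contrapT => nosmall.
  have FN : F (\bigcap_(a in A) ~` dball a n.+1%:R^-1).
    apply: filter_bigcap_finite => // a Aa.
    have [Fa|//] := in_ultra_setVsetC (dball a n.+1%:R^-1) FU.
    by exfalso; apply: nosmall; exists a => //; exact: AK.
  have [x [Kx xN]] := filter_ex (filterI FK FN).
  by have [a Aa ax] := Amax _ Kx; exact: (xN a).
have /choice[c cP] : forall n, exists c, K c /\ F (dball c n.+1%:R^-1).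
  by move=> n; have [c] := small n; exists c.
have [z zc] := clus c (fun n => (cP n).1).
have Fz : F --> z.
  move=> U /nbhsd[e e0 eU]; rewrite nbhs_simpl.
  have e20 : 0 < e / 2 by rewrite divr_gt0.
  have [n nP] := ex_natSinv e20.
  have [m [zm nm]] : exists m, dball z (e / 2) (c m) /\ (n <= m)%N.
    apply: contrapT => nom; apply: (zc _ (nbhs_dball z e20)).
    apply: sub_finite_set (finite_II n) => m /= zm.
    by rewrite ltnNge; apply/negP => nm; apply: nom; exists m.
  apply: filterS (cP m).2 => y my; apply: eU.
  have := nP m nm; have := dT z (c m) y; move: zm my.
  by rewrite /dball/=; set r : R := m.+1%:R^-1; lra.
exists z; split=> //; apply: cK => W zW.
exact: filter_ex (filterI FK (Fz _ zW)).
Qed.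

(** Balls of radius [1 / (n + 1)] about a sequence in [closure U] without cluster points meet [U];
    the shrinking radii make them locally finite. *)
Lemma noncompact_locally_finite (U : set X) : open U -> ~ compact (closure U) ->
  exists V : nat -> set X, locally_finite setT V /\
    forall n, [/\ open (V n), V n !=set0 & V n `<=` U].
Proof.
move=> oU ncU.
have [x [Ux xclus]] := noncompact_sequence (@closed_closure _ U) ncU.
exists (fun n => dball (x n) n.+1%:R^-1 `&` U); split; last first.
  move=> n; split; [exact/openI|idtac|by move=> y []].
  rewrite setIC; apply: (Ux n); apply: nbhs_dball; by rewrite invr_gt0.
move=> z; have [W /nbhsd[e e0 eW] finW] := xclus z.
have e20 : 0 < e / 2 by rewrite divr_gt0.
have [n nP] := ex_natSinv e20.
exists (dball z (e / 2)); first exact: nbhs_dball.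
apply: (@sub_finite_set _ _ ([set k | W (x k)] `|` `I_n)); last first.
  by rewrite finite_setU; split=> //; exact: finite_II.
move=> k [_ [y [zy [ky _]]]]; have [kn|nk] := ltnP k n; [by right|left].
apply: eW; have := nP k nk; have := dT z y (x k); move: zy ky.
by rewrite /dball/= (dC y (x k)); set r : R := k.+1%:R^-1; lra.
Qed.

End metrized_spaces.

(** * Remote points and open sets *)

Lemma nowhere_dense_boundary (X : topologicalType) (U : set X) :
  open U -> nowhere_dense (closure U `\` U).
Proof.
move=> oU; have cD : closed (closure U `\` U).
  by rewrite setDE; apply: closedI; [exact: closed_closure|exact: open_closedC].
rewrite /nowhere_dense -(closure_id _).1//; apply/seteqP; split=> // x xD.
have [y [Uy [_ NUy]]] := (nbhs_singleton xD).1 _ xD.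
exact: NUy.
Qed.

Lemma open_lc_points (X : topologicalType) : open (lc_points X).
Proof.
rewrite openE => x [K xK cK]; rewrite /interior.
by apply: filterS (nbhs_interior xK) => y yK; exists K.
Qed.

(** * Closures in the Cech-Stone compactification *)

Section stone_cech_metrizable.
Context {R : realType} {X bX : topologicalType} {e : X -> bX}.
Hypotheses (mX : metrizable R X) (betaX : stone_cech e).

Let bK : compact [set: bX] := stone_cech_compact betaX.
Let bH : hausdorff_space bX := stone_cech_hausdorff betaX.

Notation cl U := (closure (e @` U)).

Lemma stone_cech_continuous : continuous e.
Proof.
have [_ eP] := stone_cech_embedding betaX.
by apply/continuousP => V oV; apply/eP; exists V.
Qed.

Lemma cl_inclusion (A : set X) x : cl A (e x) -> closure A x.
Proof.
move=> xA B; rewrite nbhsE => -[U [oU Ux] UB].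
have [_ /(_ U)[/(_ oU)[V oV UV] _]] := stone_cech_embedding betaX.
have [|_ [[y Ay <-] Vy]] := xA V.
  by apply: open_nbhs_nbhs; split=> //; rewrite UV in Ux.
by exists y; split=> //; apply: UB; rewrite UV.
Qed.

Lemma clS (A B : set X) : A `<=` B -> cl A `<=` cl B.
Proof. by move=> AB; apply/closureS/image_subset. Qed.

Lemma clU (A B : set X) : cl (A `|` B) = cl A `|` cl B.
Proof. by rewrite image_setU closureU. Qed.

Lemma cl_closure (A : set X) : cl (closure A) = cl A.
Proof.
apply/seteqP; split; last by apply: clS; exact: subset_closure.
rewrite [X in _ `<=` X](closure_id _).1; last exact: closed_closure.
apply: closureS => _ [x xA <-] B /stone_cech_continuous /xA [y [Ay By]].
by exists (e y); split=> //; exists y.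
Qed.

(** The image of [K] is compact, hence already closed in the Hausdorff space [bX]. *)
Lemma cl_compact (A K : set X) : compact K -> A `<=` K -> cl A `<=` range e.
Proof.
move=> cK AK; apply: (@subset_trans _ (e @` K)); last exact: image_subset.
have cE : closed (e @` K).
  apply: compact_closed => //; apply: continuous_compact => //.
  exact/continuous_subspaceT/stone_cech_continuous.
by rewrite [X in _ `<=` X](closure_id _).1//; apply: clS.
Qed.

(** A Urysohn function for [A] and [B] extends to [bX], where it is 0 on [cl A] and 1 on [cl B]. *)
Lemma cl_disjoint (A B : set X) : closed A -> closed B -> A `&` B = set0 ->
  cl A `&` cl B = set0.
Proof.
move=> cA cB AB0; have [f [cf f01 fA fB]] := metrizable_separation mX cA cB AB0.
pose K := set_type (`[0%R, 1%R] : set R).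
have cK : compact [set: K] by apply: compact_set_type; exact: segment_compact.
have hK : hausdorff_space K by apply: hausdorff_set_type; exact: Rhausdorff.
pose fK x : K :=
  exist _ (f x) (mem_set (f01 _ (imageP f (Logic.I : [set: X] x)))).
have cfK : continuous fK by apply: continuous_comp_initial.
have [F cF FE] := stone_cech_extension betaX cK hK cfK.
pose G p : R := set_val (F p).
have cG : continuous G.
  by move=> p; apply: continuous_comp; [exact: cF|exact: initial_continuous].
have Gcst (C : set X) (c : R) : (forall x, C x -> f x = c) ->
    cl C `<=` G @^-1` [set c].
  move=> fC; have cGc : closed (G @^-1` [set c]).
    by apply: preimage_closed => // p _; exact: cG.
  rewrite [X in _ `<=` X](closure_id _).1//; apply: closureS => _ [x Cx <-].
  by rewrite /G /= FE; exact: fC.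
apply/seteqP; split=> // p [/(Gcst _ _ fA) /= G0 /(Gcst _ _ fB) /= G1].
by have := @oner_neq0 R; rewrite -G1 G0 eqxx.
Qed.

Lemma stone_cech_regular p (G : set bX) : nbhs p G ->
  exists2 W, open_nbhs p W & closure W `<=` G.
Proof.
move=> pG; have [W pW WG] := @compact_regular _ p _ bH bK filterT _ pG.
exists W°; first by split; [exact: open_interior|].
by apply: subset_trans WG; apply: closureS; exact: interior_subset.
Qed.

(** Localization of [cl_disjoint]: within a closed neighbourhood of [p] missing [cl (A]&[B)], the
    traces of [A] and [B] are disjoint, yet [p] adheres to both. *)
Lemma cl_setI (A B : set X) : closed A -> closed B ->
  cl A `&` cl B `<=` cl (A `&` B).
Proof.
move=> cA cB p [pA pB]; apply: contrapT => pNAB.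
have [|W [oW Wp] WAB] := @stone_cech_regular p (~` cl (A `&` B)).
  by apply: open_nbhs_nbhs; split=> //; exact/closed_openC/closed_closure.
pose N := e @^-1` closure W.
have cN : closed N.
  apply: preimage_closed => [x _|]; first exact: stone_cech_continuous.
  exact: closed_closure.
have clN (C : set X) : cl C p -> cl (C `&` N) p.
  move=> pC G pG; have [|_ [[x Cx <-] [Gx Wx]]] := pC (G `&` W).
    by apply: filterI => //; exact: open_nbhs_nbhs.
  exists (e x); split=> //; exists x => //; split=> //.
  exact: subset_closure.
have : (cl (A `&` N) `&` cl (B `&` N)) p by split; exact: clN.
rewrite cl_disjoint//; try exact: closedI.
apply/seteqP; split=> // x [[Ax Nx] [Bx _]]; apply: (WAB (e x)) => //.
by apply: subset_closure; exists x.
Qed.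

(** [U]&[V] and the boundaries of [U] and [V] cover [closure U]&[closure V], and a remote point
    adheres to no boundary. *)
Lemma remote_clI p (U V : set X) : remote e p -> open U -> open V ->
  cl U p -> cl V p -> cl (U `&` V) p.
Proof.
move=> [_ _ remp] oU oV Up Vp.
have : cl ((U `&` V) `|` ((closure U `\` U) `|` (closure V `\` V))) p.
  apply: (@clS (closure U `&` closure V)).
    move=> x [Ux Vx]; have [?|?] := pselect (U x); last by right; left.
    by have [?|?] := pselect (V x); [left|right; right].
  by apply: cl_setI; rewrite ?cl_closure//; exact: closed_closure.
by rewrite !clU => -[//|[|]] pD; exfalso;
  apply: remp pD; exact: nowhere_dense_boundary.
Qed.

Lemma remote_cl0 p (U V : set X) : remote e p -> open U -> open V ->
  U `&` V = set0 -> cl U p -> cl V p -> False.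
Proof.
move=> remp oU oV UV0 Up Vp; have := remote_clI remp oU oV Up Vp.
by rewrite UV0 image_set0 closure0.
Qed.

Lemma remote_clC p (U : set X) : remote e p -> open U ->
  cl (~` closure U) p <-> ~ cl U p.
Proof.
move=> remp oU.
have oC : open (~` closure U) by exact/closed_openC/closed_closure.
split=> [Cp Up|NUp].
  apply: (remote_cl0 remp oU oC) => //; rewrite -subset0 => x [Ux]; apply.
  exact: subset_closure.
have [ep _ remD] := remp.
have : cl (U `|` ((closure U `\` U) `|` ~` closure U)) p.
  apply: clS ep => x _; have [?|?] := pselect (U x); first by left.
  by right; have [?|?] := pselect (closure U x); [left|right].
by rewrite !clU => -[//|[pD|//]]; exfalso;
  apply: remD pD; exact: nowhere_dense_boundary.
Qed.

(** * The clopen base of the space of remote points *)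

Definition rho (U : set X) : set (remote e) := [set p | cl U (val p)].

Lemma remoteP (p : remote e) : remote e (val p).
Proof. exact: set_valP. Qed.

Lemma rhoS (U V : set X) : U `<=` V -> rho U `<=` rho V.
Proof. by move=> UV p; exact: clS. Qed.

Lemma rhoC (U : set X) : open U -> rho (~` closure U) = ~` rho U.
Proof. by move=> oU; apply/seteqP; split=> p /(remote_clC (remoteP p) oU). Qed.

Lemma open_rho (U : set X) : open U -> open (rho U).
Proof.
move=> oU; suff -> : rho U = val @^-1` (~` cl (~` closure U)).
  by exists (~` cl (~` closure U)) => //; exact/closed_openC/closed_closure.
apply/seteqP; split=> p; rewrite /rho /=.
- by move=> Up /(remote_clC (remoteP p) oU).
- by move=> Np; apply: contrapT => /(remote_clC (remoteP p) oU).
Qed.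

(** By regularity of [bX], shrink to an open [W] with closure in the given neighbourhood, and trace
    [W] on [X]; [p] adheres to the trace because it adheres to [range e]. *)
Lemma rho_base (p : remote e) (G : set (remote e)) : nbhs p G ->
  exists U, [/\ open U, rho U p & rho U `<=` G].
Proof.
move=> [_ /= [[V oV <-] Vp VG]].
have [|W [oW Wp] WV] := @stone_cech_regular (val p) V.
  exact: open_nbhs_nbhs.
exists (e @^-1` W); split.
- by apply: open_comp => // x _; exact: stone_cech_continuous.
- have [ep _ _] := remoteP p; move=> B pB.
  have [|_ [[x _ <-] [Bx Wx]]] := ep (B `&` W).
    by apply: filterI => //; exact: open_nbhs_nbhs.
  by exists (e x); split=> //; exists x.
- move=> q Wq; apply: VG; apply: WV; apply: closureS Wq.
  exact: image_preimage_subset.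
Qed.

(** The point is that a set [D] nowhere dense in the subspace [closure U] is nowhere dense in [X]:
    the interior [W] of its closure lies in [closure U], so it is open there too. *)
Lemma remote_in_closure (U : set X) : remote_in e (closure U) = rho U.
Proof.
have rangeE : range (e \o (set_val : closure U -> X)) = e @` closure U.
  apply/seteqP; split=> [_ [x _ <-]|_ [x Ux <-]].
    by exists (set_val x) => //; exact: set_valP.
  by exists (exist _ x (mem_set Ux)).
rewrite /remote_in /rho; apply/seteqP; split=> p /=.
  by move=> [+ _ _]; rewrite rangeE cl_closure.
move=> Up; have [ep rp Dp] := remoteP p; split.
- by rewrite rangeE cl_closure.
- by move=> [x _ xp]; apply: rp; exists (set_val x).
- move=> D ndD; rewrite -image_comp; apply: Dp.
  rewrite /nowhere_dense -subset0 => x xW.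
  set W := (closure (set_val @` D))° in xW.
  have oW : open W by exact: open_interior.
  have WU : W `<=` closure U.
    apply: subset_trans (@interior_subset _ _) _ => //.
    rewrite [X in _ `<=` X](closure_id _).1; last exact: closed_closure.
    by apply: closureS => _ [y _ <-]; exact: set_valP.
  have WD : (closure D)° (exist _ x (mem_set (WU _ xW))).
    apply: (@filterS _ _ _ (set_val @^-1` W)); last first.
      by apply: initial_continuous; exact: open_nbhs_nbhs.
    move=> y Wy B [_ /= [[V oV <-] Vy VB]].
    have Dy : closure (set_val @` D) (set_val y) by exact: interior_subset Wy.
    have [_ [[z Dz <-] Vz]] := Dy _ (open_nbhs_nbhs (conj oV Vy)).
    by exists z; split=> //; exact: VB.
  by rewrite ndD in WD.
Qed.

End stone_cech_metrizable.

(** * Existence of remote points *)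

Lemma locally_finite_tail (X : topologicalType) (V : nat -> set X) (x : X) :
  locally_finite setT V -> exists W N, nbhs x W /\
  forall n, (N <= n)%N -> W `&` V n = set0.
Proof.
move=> lfV; have [W xW finW] := lfV x; exists W.
(* A finite set of indices is bounded: eventually [n] exceeds each of them. *)
have := @filter_bigcap_finite _ _ \oo _ (fun i => [set n | (i < n)%N]) _ finW.
case=> [i _|N _ NP]; first by exists i.+1.
exists N; split=> // n Nn; rewrite -subset0 => y Wy.
suff : (n < n)%N by rewrite ltnn.
by apply: (NP n Nn n); split=> //; exists y.
Qed.

(* H m D B is a shrinking of B away from D, built by descending m times: pick a
   member p of the pi-base inside B with closure missing D, say of level g, and
   add the shrinkings H (m - 1) D C of all the members C of level g in B. Among
   finitely many D, take D1 with the least level: its p is one of the C for all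
   the others. Levels being locally finite, the closures of the unions still
   miss D. *)
Lemma linked_families (R : realType) (X : topologicalType) :
  metrizable R X -> exists H : nat -> set X -> set X -> set X,
  [/\ forall m D B, nowhere_dense D -> open B -> B !=set0 -> H m D B `<=` B,
      forall m D B, nowhere_dense D -> open B -> B !=set0 ->
        closure (H m D B) `&` closure D = set0 &
      forall m (s : seq (set X)) B,
        (forall D, D \in s -> nowhere_dense D) -> (size s <= m)%N ->
        open B -> B !=set0 ->
        exists2 x, B x & forall D, D \in s -> H m D B x].
Proof.
move=> mX; have [d dX] := metrizableE mX.
have [P [lfP oP incP baseP]] := metrized_pi_base dX.
(* The hypotheses sit inside the existential so that choice gives a total function; the pair of 0
   and [set0] is the default. *)
have piece (DB : set X * set X) : exists gp : nat * set X,
    nowhere_dense DB.1 -> open DB.2 -> DB.2 !=set0 ->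
    [/\ P gp.1 gp.2, gp.2 `<=` DB.2 & closure gp.2 `&` closure DB.1 = set0].
  case: DB => D B /=.
  have [[ndD oB B0]|N] := pselect [/\ nowhere_dense D, open B & B !=set0];
    last by exists (0%N, set0) => *; exfalso; apply: N.
  have [x [Bx Dx]] : B `&` ~` closure D !=set0.
    apply/set0P/negP => /eqP BD0; have [x Bx] := B0.
    have : (closure D)° x; last by rewrite ndD.
    apply: filterS (open_nbhs_nbhs (conj oB Bx)) => y By.
    by apply: contrapT => Dy; have : (B `&` ~` closure D) y by []; rewrite BD0.
  have [|W [oW Wx] WD] := @metrizable_regular _ _ x (B `&` ~` closure D) mX.
    apply: open_nbhs_nbhs; split=> //; apply: openI => //.
    exact/closed_openC/closed_closure.
  have [n [V [PV VW]]] := baseP W oW (ex_intro _ x Wx).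
  exists (n, V) => _ _ _; split=> //= [y /VW /subset_closure /WD[]//|].
  by rewrite -subset0 => y [/(closureS VW) /WD[_]].
have [gp gpP] := choice piece.
pose H := fix H m D B := if m is m'.+1 then (gp (D, B)).2 `|`
  \bigcup_(C in [set C | P (gp (D, B)).1 C /\ C `<=` B]) H m' D C else set0.
have HB m D B : nowhere_dense D -> open B -> B !=set0 -> H m D B `<=` B.
  elim: m B => [|m IHm] B ndD oB B0 //=; have [_ pB _] := gpP (D, B) ndD oB B0.
  rewrite subUset; split=> //; apply: bigcup_sub => C [PC CB].
  by have [oC C0] := oP _ _ PC; apply: subset_trans CB; exact: IHm.
exists H; split=> //.
- elim=> [|m IHm] D B ndD oB B0 /=; first by rewrite closure0 set0I.
  have [_ _ pD] := gpP (D, B) ndD oB B0.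
  rewrite closureU setIUl pD set0U -subset0 => x [xH xD].
  have [C [PC CB] xC] : (\bigcup_(C in [set C | P (gp (D, B)).1 C /\ C `<=` B])
      closure (H m D C)) x.
    apply: closure_locally_finite xH.
    apply: locally_finite_sub (lfP (gp (D, B)).1) => [C []//|C [/oP[oC C0] _]].
    exact: HB.
  by have [oC C0] := oP _ _ PC; rewrite -(IHm D C ndD oC C0).
- elim=> [|m IHm] s B nds sm oB [b Bb].
    (* The value [set0] at depth 0 is harmless: [s] is then empty. *)
    by move: sm nds; rewrite leqn0 size_eq0 => /eqP -> _; exists b.
  have B0 : B !=set0 by exists b.
  have [/hasP[D0 D0s _]|/hasPn s0] := boolP (has predT s); last first.
    by exists b => // D /s0.
  have exg : exists n, has (fun D => (gp (D, B)).1 == n) s.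
    by exists (gp (D0, B)).1; apply/hasP; exists D0.
  case: (ex_minnP exg) => n /hasP[D1 D1s /eqP gD1] gmin.
  have [Pp pB pD] := gpP (D1, B) (nds _ D1s) oB B0; rewrite /= in Pp pB pD.
  have [op p0] := oP _ _ Pp.
  have [||x px xs] := IHm (rem D1 s) (gp (D1, B)).2 _ _ op p0.
  + by move=> D /mem_rem; exact: nds.
  + by rewrite size_rem// -ltnS prednK//; case: (s) D1s.
  exists x; first exact: pB.
  move=> D Ds; have [->|DD1] := eqVneq D D1; first by left.
  right; exists (gp (D1, B)).2.
    split=> //; apply: incP Pp; rewrite gD1; apply: gmin.
    by apply/hasP; exists D.
  apply: xs; have := perm_mem (perm_to_rem D1s) D.
  by rewrite Ds inE (negPf DD1) /= => <-.
Qed.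

Section existence.
Context {R : realType} {X bX : topologicalType} {e : X -> bX}.
Hypotheses (mX : metrizable R X) (betaX : stone_cech e).

Notation cl U := (closure (e @` U)).

(** In [V n] the shrinkings have depth [n], so those for a finite list [s] have a common point as
    soon as [n] is at least [size s]. This makes [F] a proper filter, and any cluster point of it is
    remote. *)
Lemma exists_remote (V : nat -> set X) : locally_finite setT V ->
  (forall n, open (V n) /\ V n !=set0) -> exists p : remote e,
  forall k, rho (\bigcup_(n in [set n | (k <= n)%N]) V n) p.
Proof.
move=> lfV oV; have [H [HV HD Hlink]] := linked_families mX.
pose F : set_system bX := [set A | exists (s : seq (set X)) k,
  (forall D, D \in s -> nowhere_dense D) /\
  forall n x, (k <= n)%N -> V n x -> (forall D, D \in s -> H n D (V n) x) ->
    A (e x)].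
have FP : ProperFilter F.
  split.
    move=> [s [k [nds /(_ (maxn k (size s)))]]].
    have [oVn Vn0] := oV (maxn k (size s)).
    have [x Vx Hx] := Hlink _ s _ nds (leq_maxr k _) oVn Vn0.
    by apply; [exact: leq_maxl|exact: Vx|].
  split.
  - by exists [::], 0%N.
  - move=> A B [s [k [nds sA]]] [t [l [ndt tB]]].
    exists (s ++ t), (maxn k l); split=> [D|n x].
      by rewrite mem_cat => /orP[/nds|/ndt].
    rewrite geq_max => /andP[kn ln] Vx Hx; split.
      by apply: (sA n) => // D Ds; apply: Hx; rewrite mem_cat Ds.
    by apply: (tB n) => // D Dt; apply: Hx; rewrite mem_cat Dt orbT.
  - move=> A B AB [s [k [nds sA]]]; exists s, k; split=> // n x kn Vx Hx.
    by apply: AB; exact: sA Hx.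
have [p [_ pF]] := stone_cech_compact betaX FP (@filterT _ F _).
have pV k : cl (\bigcup_(n in [set n | (k <= n)%N]) V n) p.
  move=> B; apply: pF; exists [::], k; split=> // n x kn Vx _.
  by exists x => //; exists n.
have remp : remote e p.
  split; first by apply: closureS (pV 0%N) => _ [x _ <-]; exists x.
  - move=> [x _ xp]; have [W [N [xW WV]]] := locally_finite_tail x lfV.
    have := pV N; rewrite -xp => /(cl_inclusion betaX) /(_ W xW).
    move=> [y [[n Nn Vy] Wy]].
    by have : (W `&` V n) y by []; rewrite WV.
  (* [G] belongs to the filter up to [e], and its closure misses [closure D] by local finiteness. *)
  - move=> D ndD pD; pose G := \bigcup_n H n D (V n).
    have pG : cl G p.
      move=> B; apply: pF; exists [:: D], 0%N; split=> [E|n x _ Vx /(_ D)].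
        by rewrite inE => /eqP ->.
      by rewrite inE eqxx => /(_ isT) Hx; exists x => //; exists n.
    have : (cl (closure G) `&` cl (closure D)) p.
      by rewrite !(cl_closure betaX).
    rewrite (cl_disjoint mX betaX)//; try exact: closed_closure.
    rewrite -subset0 => x [xG xD].
    have [n _ xn] : (\bigcup_n closure (H n D (V n))) x.
      apply: closure_locally_finite xG.
      apply: locally_finite_sub lfV => // n _; have [oVn Vn0] := oV n.
      exact: HV.
    by have [oVn Vn0] := oV n; rewrite -(HD n D (V n) ndD oVn Vn0).
by exists (exist _ p (mem_set remp)).
Qed.

End existence.

(** * The locally compact and the nowhere locally compact part *)

Definition relatively_compact (X : topologicalType) (A : set X) :=
  exists2 K, compact K & A `<=` K.

Lemma relatively_compact_bigcup (X : topologicalType) (V : nat -> set X) k :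
  (forall n, relatively_compact (V n)) ->
  relatively_compact (\bigcup_(n in [set n | (n < k)%N]) V n).
Proof.
move=> cV; elim: k => [|k [K cK VK]].
  by exists set0; [exact: compact0|move=> x []].
have [L cL VL] := cV k; exists (K `|` L); first exact: compactU.
move=> x [n /=]; rewrite ltnS leq_eqVlt => /orP[/eqP -> Vx|nk Vx].
  by right; exact: VL.
by left; apply: VK; exists n.
Qed.

Section rho_topology.
Context {R : realType} {X bX : topologicalType} {e : X -> bX}.
Hypotheses (mX : metrizable R X) (betaX : stone_cech e).

Lemma rho_relatively_compact (U : set X) (p : remote e) :
  relatively_compact U -> ~ rho U p.
Proof.
move=> [K cK UK] /(cl_compact betaX cK UK) pr.
by have [_ + _] := remoteP p; apply.
Qed.

Lemma rho_noncompact (U : set X) (p : remote e) : rho U p ->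
  ~ compact (closure U).
Proof.
move=> Up cU; apply: rho_relatively_compact Up.
by exists (closure U) => //; exact: subset_closure.
Qed.

(** Inclusion up to a relatively compact error suffices, since such a set has no remote points in
    its closure. *)
Lemma rho_sub_setU (U V W : set X) : relatively_compact V -> W `<=` V `|` U ->
  @rho _ _ e W `<=` rho U.
Proof.
move=> cV WUV p /(rhoS WUV); rewrite /rho /= clU => -[Vp|//].
by exfalso; exact: (rho_relatively_compact cV Vp).
Qed.

Lemma rhoI (U V : set X) : open U -> open V ->
  @rho _ _ e U `&` rho V `<=` rho (U `&` V).
Proof.
move=> oU oV p [Up Vp].
exact: (remote_clI mX betaX (remoteP p) oU oV).
Qed.

Lemma rho_set0 (p : remote e) : ~ rho set0 p.
Proof. by rewrite /rho /= image_set0 closure0. Qed.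

Lemma noncompact_open_sequence (U : set X) : open U -> ~ compact (closure U) ->
  exists V : nat -> set X, locally_finite setT V /\
    forall n, [/\ open (V n), V n !=set0 & V n `<=` U].
Proof.
by have [d dX] := metrizableE mX; exact: noncompact_locally_finite dX _.
Qed.

Lemma rho_neq0 (U : set X) : open U -> ~ compact (closure U) ->
  @rho _ _ e U !=set0.
Proof.
move=> oU ncU; have [V [lfV VP]] := noncompact_open_sequence oU ncU.
have [|p pV] := exists_remote mX betaX lfV.
  by move=> n; have [] := VP n.
exists p; apply: rhoS (pV 0%N) => x [n _ Vx].
by have [_ _] := VP n; apply.
Qed.

(** Decreasing open sets [I k] with [q] in [rho (I k)] and [rho (I k)] inside [C k] are sampled by
    [V' k], a piece of [I k]. The union of the samples lies in [I k] except for the first [k], which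
    are relatively compact. *)
Lemma lc_rho_Gdelta (V : nat -> set X) (C : nat -> set (remote e))
    (q : remote e) :
  locally_finite setT V -> (forall n, open (V n)) ->
  (forall n, relatively_compact (V n)) ->
  (forall k, open (C k)) -> rho (\bigcup_n V n) q -> (forall k, C k q) ->
  exists U, [/\ open U, @rho _ _ e U !=set0, U `<=` \bigcup_n V n &
    forall k, rho U `<=` C k].
Proof.
move=> lfV oV cV oC qV qC.
have /choice[U UP] : forall k, exists U, [/\ open U, rho U q & rho U `<=` C k].
  by move=> k; apply: rho_base => //; exact: open_nbhs_nbhs.
pose I := fix I k := if k is j.+1 then I j `&` U k else U 0%N `&` \bigcup_n V n.
have oI k : open (I k).
  elim: k => [|k IHk] /=; last by apply: openI => //; have [] := UP k.+1.
  by apply: openI; [have [] := UP 0%N|exact: bigcup_open].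
have qI k : rho (I k) q.
  elim: k => [|k IHk] /=; have [oU qU _] := UP 0%N.
    by apply: rhoI => //; exact: bigcup_open.
  by have [oUk qUk _] := UP k.+1; exact: rhoI.
have decI m n : (m <= n)%N -> I n `<=` I m.
  elim: n => [|n IHn]; first by rewrite leqn0 => /eqP ->.
  by rewrite leq_eqVlt => /orP[/eqP -> //|/IHn mn x [/mn]].
have IU k : I k `<=` U k by case: k => [|k] x [].
have IV : I 0%N `<=` \bigcup_n V n by move=> x [].
(* Otherwise [I k] would lie in the union of the first [k] sets [V n], which is relatively
   compact. *)
have /choice[n nP] : forall k, exists n, (k <= n)%N /\ I k `&` V n !=set0.
  move=> k; apply: contrapT => non.
  apply: rho_relatively_compact (qI k).
  have [K cK VK] := relatively_compact_bigcup k cV; exists K => // x Ix.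
  apply: VK; have [m _ Vx] := IV _ (decI 0%N k (leq0n k) x Ix).
  exists m => //=; rewrite ltnNge; apply/negP => km.
  by apply: non; exists m; split=> //; exists x.
pose V' k := I k `&` V (n k).
have lfV' : locally_finite setT V'.
  move=> x; have [W [N [xW WN]]] := locally_finite_tail x lfV; exists W => //.
  apply: sub_finite_set (finite_II N) => k [_ [y [Wy [_ Vy]]]] /=.
  rewrite ltnNge; apply/negP => Nk; have [kn _] := nP k.
  by have : (W `&` V (n k)) y by []; rewrite WN// (leq_trans Nk).
have V'P k : open (V' k) /\ V' k !=set0.
  by split; [exact: openI|have [] := nP k].
exists (\bigcup_k V' k); split.
- by apply: bigcup_open => k _; have [] := V'P k.
- have [p pV'] := exists_remote mX betaX lfV' V'P; exists p.
  by apply: rhoS (pV' 0%N) => x [k _ V'x]; exists k.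
- by move=> x [k _ [_ Vx]]; exists (n k).
- move=> k; have [_ _ UC] := UP k; apply: subset_trans UC.
  apply: (@rho_sub_setU _ (\bigcup_(j in [set j | (j < k)%N]) V' j)).
    apply: relatively_compact_bigcup => j; have [K cK VK] := cV (n j).
    by exists K => // x [_ /VK].
  move=> x [j _ V'x]; have [jk|kj] := ltnP j k; first by left; exists j.
  by right; apply: IU; apply: decI kj _ _; have [] := V'x.
Qed.

(** If [rho S] lay in every [rho (W k)], then [S] would meet [W 0] at some [y]. Near [y] some tail
    [W k] is absent, but a small open set [T] in [S] around [y] still has remote points, and these
    would lie in [rho (T]&[W k)]. *)
Lemma nlc_rho_Gdelta (U : set X) (q : remote e) : open U ->
  U `<=` nlc_points X -> rho U q ->
  exists C : nat -> set (remote e), [/\ forall k, open (C k),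
    exists2 p, rho U p & forall k, C k p &
    forall S, open S -> @rho _ _ e S !=set0 -> ~ (forall k, rho S `<=` C k)].
Proof.
move=> oU Unlc qU.
have [V [lfV VP]] := noncompact_open_sequence oU (rho_noncompact qU).
pose W k := \bigcup_(n in [set n | (k <= n)%N]) V n.
have oW k : open (W k) by apply: bigcup_open => n _; have [] := VP n.
have WU k : W k `<=` U by move=> x [n _ Vx]; have [_ _] := VP n; apply.
exists (fun k => rho (W k)); split.
- by move=> k; exact: (open_rho mX betaX).
- have [|p pW] := exists_remote mX betaX lfV.
    by move=> n; have [] := VP n.
  by exists p => //; exact: rhoS (WU 0%N) _ (pW 0%N).
- move=> S oS [r Sr] SW.
  have [y [Sy Wy]] : S `&` W 0%N !=set0.
    apply/set0P/negP => /eqP SW0; apply: (@rho_set0 r); rewrite -SW0.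
    by apply: rhoI => //; split=> //; exact: SW.
  have [N [k [yN Nk]]] := locally_finite_tail y lfV.
  pose T := S `&` (N° `&` W 0%N).
  have oT : open T.
    by apply: openI => //; apply: openI => //; exact: open_interior.
  (* A compact [closure T] would be a compact neighbourhood of [y]. *)
  have ncT : ~ compact (closure T).
    move=> cT; apply: (Unlc y (WU 0%N y Wy)); apply: subset_closure.
    exists (closure T) => //; apply: filterS (@subset_closure _ T) _.
    exact: open_nbhs_nbhs.
  have [s Ts] := rho_neq0 oT ncT.
  apply: (@rho_set0 s); rewrite (_ : set0 = T `&` W k).
    by apply: rhoI => //; split=> //; apply: SW; apply: rhoS Ts => x [].
  apply/seteqP; split=> // x [[_ [/interior_subset Nx _]] [n kn Vx]].
  by rewrite -(Nk n kn).
Qed.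

(** Each term of a locally finite sequence in [U] is cut down to the interior of a compact
    neighbourhood of one of its points. *)
Lemma lc_open_sequence (U : set X) (p : remote e) : open U ->
  U `<=` lc_points X -> rho U p -> exists V : nat -> set X,
  locally_finite setT V /\ forall n,
    [/\ open (V n), V n !=set0, V n `<=` U & relatively_compact (V n)].
Proof.
move=> oU Ulc pU.
have [V [lfV VP]] := noncompact_open_sequence oU (rho_noncompact pU).
have /choice[K KP] : forall n, exists K, compact K /\ V n `&` K° !=set0.
  move=> n; have [oV [x Vx] VU] := VP n.
  by have [K xK cK] := Ulc _ (VU _ Vx); exists K; split=> //; exists x.
exists (fun n => V n `&` (K n)°); split.
  by apply: locally_finite_sub lfV => // n _ x [].
move=> n; have [oV _ VU] := VP n; have [cK VK] := KP n; split=> //.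
- by apply: openI => //; exact: open_interior.
- by move=> x [/VU].
- by exists (K n) => // x [_ /interior_subset].
Qed.

End rho_topology.

(** Were [h p] in the other part, some [rho VV] of the locally compact part would be sent into that
    part. There a G_delta without interior is found, and its preimage contradicts
    [lc_rho_Gdelta]. *)
Lemma homeomorphism_rho_lc (R : realType) (X Y : topologicalType)
    (metrizableX : metrizable R X) (metrizableY : metrizable R Y)
    (bX bY : topologicalType) (eX : X -> bX) (eY : Y -> bY)
    (betaX : stone_cech eX) (betaY : stone_cech eY)
    (h : remote eX -> remote eY) (homeo_h : homeomorphism h) :
  h @` rho (lc_points X) `<=` rho (lc_points Y).
Proof.
have [g [hK gK ch cg]] := homeo_h.
have olX := @open_lc_points X; have olY := @open_lc_points Y.
have onY : open (nlc_points Y) by exact/closed_openC/closed_closure.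
move=> _ [p pX <-]; apply: contrapT => hpY.
have {}hpY : rho (nlc_points Y) (h p) by rewrite /nlc_points (rhoC metrizableY).
have [|U [oU Up UG]] :=
  rho_base betaX (p := p) (G := h @^-1` rho (nlc_points Y)).
  apply: ch; apply: open_nbhs_nbhs; split=> //.
  exact: (open_rho metrizableY betaY).
have [|||V [lfV VP]] :=
  @lc_open_sequence _ _ _ _ metrizableX betaX (U `&` lc_points X) p.
- exact: openI.
- by move=> x [].
- exact: (rhoI metrizableX).
set VV := \bigcup_n V n.
have oVV : open VV by apply: bigcup_open => n _; have [] := VP n.
have VVU : VV `<=` U.
  by move=> x [n _ Vx]; have [_ _ + _] := VP n => /(_ _ Vx) [].
have [q0 q0V] : @rho _ _ eX VV !=set0.
  have [|q qV] := exists_remote metrizableX betaX lfV.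
    by move=> n; have [] := VP n.
  by exists q; apply: rhoS (qV 0%N) => x [n _ Vx]; exists n.
(* [T] keeps the G_delta point within the image of [rho VV], where [lc_rho_Gdelta] applies. *)
have [|T [oT Tq TG]] := rho_base betaY (p := h q0) (G := g @^-1` rho VV).
  apply: cg; rewrite hK; apply: open_nbhs_nbhs; split=> //.
  exact: (open_rho metrizableX betaX).
have [|||C [oC [q qT qC] CS]] :=
    @nlc_rho_Gdelta _ _ _ _ metrizableY betaY (T `&` nlc_points Y) (h q0).
- exact: openI.
- by move=> x [].
- by apply: (rhoI metrizableY) => //; split=> //; apply: UG; exact: rhoS q0V.
have qV : rho VV (g q) by apply: TG; apply: rhoS qT => x [].
have [|||||S [oS [r Sr] SV SC]] := @lc_rho_Gdelta _ _ _ _ metrizableX betaX V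
    (fun k => h @^-1` C k) (g q) lfV.
- by move=> n; have [] := VP n.
- by move=> n; have [] := VP n.
- by move=> k; apply: open_comp => // x _; exact: ch.
- exact: qV.
- by move=> k; rewrite /= gK.
(* The interior [rho S] found in [X] is carried back to a basic open set of [Y] inside all [C k]. *)
have [|S' [oS' S'r S'S]] := rho_base betaY (p := h r) (G := g @^-1` rho S).
  apply: cg; rewrite hK; apply: open_nbhs_nbhs; split=> //.
  exact: (open_rho metrizableX betaX).
apply: (CS S' oS'); first by exists (h r).
by move=> k s /S'S /= /SC /=; rewrite gK.
Qed.

Theorem corollary4p6 (R : realType) (X Y : topologicalType)
    (metrizableX : metrizable R X) (metrizableY : metrizable R Y)
    (bX bY : topologicalType) (eX : X -> bX) (eY : Y -> bY)
    (betaX : stone_cech eX) (betaY : stone_cech eY)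
    (h : remote eX -> remote eY) (homeo_h : homeomorphism h) :
  h @` remote_in eX (closure (lc_points X)) =
    remote_in eY (closure (lc_points Y)) /\
  h @` remote_in_open eX (nlc_points X) = remote_in_open eY (nlc_points Y).
Proof.
have [g [hK gK ch cg]] := homeo_h.
have olX := @open_lc_points X; have olY := @open_lc_points Y.
have lcE : h @` rho (lc_points X) = rho (lc_points Y).
  apply/seteqP; split.
    exact: (homeomorphism_rho_lc metrizableX metrizableY betaX betaY homeo_h).
  move=> q qY; exists (g q); last exact: gK.
  have homeo_g : homeomorphism g by exists h.
  apply: (homeomorphism_rho_lc metrizableY metrizableX betaY betaX homeo_g).
  by exists q.
rewrite /remote_in_open !(remote_in_closure betaX, remote_in_closure betaY)//;
  try exact/closed_openC/closed_closure.
(* The second equality is the first one for complements, as [h] is bijective. *)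
split=> //; rewrite /nlc_points (rhoC metrizableX)// (rhoC metrizableY)// -lcE.
apply/seteqP; split=> [_ [p pX <-] [q qX hpq]|q NqX].
  by apply: pX; rewrite -(hK p) -hpq hK.
by exists (g q); [move=> qX; apply: NqX; exists (g q)|exact: gK].
Qed.
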